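(* Let $m\ge 1$ and $N\ge 0$ be integers, let $C_n\in\mathbb{C}^{m\times m}$ for $-N\le n\le N$, and let $$S(z)=\sum_{n=-N}^{N} C_n z^n ,\qquad z\in\mathbb{C}\setminus\{0\}.$$ Suppose that $S(z)$ is positive definite for almost every $z\in\mathbb{T}=\{z\in\mathbb{C}:|z|=1\}$. Then there exist matrices $A_0,\dots,A_N\in\mathbb{C}^{m\times m}$ such that, with $$S^+(z)=\sum_{n=0}^{N}A_n z^n,\qquad S^-(z)=\overline{S^+(1/\overline{z})}^{\,T}=\sum_{n=0}^{N}A_n^* z^{-n},$$ one has $$S(z)=S^+(z)S^-(z)\quad\text{for all } z\in\mathbb{C}\setminus\{0\},$$ and $\det S^+(z)\neq 0$ for all $|z|<1$ (respectively, $S^-$ is analytic and nonsingular outside $\mathbb{T}$, i.e. on $\{z\in\mathbb{C}:|z|>1\}\cup\{\infty\}$). Moreover, $S^+$ is unique up to a constant right unitary multiplier: if $S_1^+$ and $S_2^+$ are two matrix polynomials of this form with these properties, then there is a constant unitary matrix $U\in\mathbb{C}^{m\times m}$ such that $S_1^+(z)=S_2^+(z)U$ for all $z$.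
   Context: For a complex matrix $A$, $A^*=\overline{A}^{\,T}$ denotes its Hermitian conjugate (conjugate transpose). ''Positive definite'' means Hermitian positive definite, and ''almost every'' refers to Lebesgue (arc length) measure on $\mathbb{T}$. A matrix function is analytic in a domain if all its entries are analytic there, and nonsingular there if its determinant has no zero there. *)

(* Defs.v *)
(* MathComp / MathComp-Analysis; the complex numbers are R[i] for R : realType. *)
From HB Require Import structures.
From mathcomp Require Import all_boot all_order all_algebra.
From mathcomp Require Import sesquilinear spectral complex.
From mathcomp Require Import all_classical all_reals all_analysis.

Set Implicit Arguments.
Unset Strict Implicit.
Unset Printing Implicit Defensive.

Import Order.TTheory GRing.Theory Num.Theory.
Import numFieldNormedType.Exports.

Local Open Scope classical_set_scope.
Local Open Scope ring_scope.
Local Open Scope sesquilinear_scope.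

(* M ^t* is the conjugate transpose. On R[i], 0 < w means that w is real and
   positive. *)
Definition posdefmx (R : realType) (m : nat) (A : 'M[R[i]]_m) : Prop :=
  A \is hermsymmx /\
  forall x : 'cV[R[i]]_m, x != 0 -> 0 < (x^t* *m A *m x) 0 0.

(* The arc length measure on the unit circle is the image of the Lebesgue
   measure on [0, 2 pi[ under the bijection t |-> e^(it). *)
Definition ae_circle (R : realType) (P : R[i] -> Prop) : Prop :=
  {ae (@lebesgue_measure R), forall t : R,
    t \in `[0, 2 * pi[ -> P (Complex (cos t) (sin t))}.

(* The family C is indexed by all of int, but only its values C n for
   - N <= n <= N are used. *)
Definition laurent_mx (R : realType) (m N : nat) (C : int -> 'M[R[i]]_m)
    (z : R[i]) : 'M[R[i]]_m :=
  \sum_(k < N.*2.+1) z ^ (k%:Z - N%:Z) *: C (k%:Z - N%:Z).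

Definition poly_mx (R : realType) (m N : nat) (A : 'I_N.+1 -> 'M[R[i]]_m)
    (z : R[i]) : 'M[R[i]]_m :=
  \sum_(n < N.+1) z ^+ n *: A n.

Definition para_adj (R : realType) (m : nat) (F : R[i] -> 'M[R[i]]_m)
    (z : R[i]) : 'M[R[i]]_m :=
  (F (1 / z^*))^t*.

Lemma para_adj_poly_mx (R : realType) (m N : nat)
    (A : 'I_N.+1 -> 'M[R[i]]_m) (z : R[i]) :
  para_adj (poly_mx A) z = \sum_(n < N.+1) z ^- n *: (A n)^t*.
Proof.
apply/matrixP => i j; rewrite /para_adj /poly_mx !mxE !summxE rmorph_sum /=.
apply: eq_bigr => n _; rewrite !mxE rmorphM; congr (_ * _).
by rewrite rmorphXn /= div1r fmorphV -exprVn; congr (_^-1 ^+ _); exact: conjCK.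
Qed.

(* Analyticity on an open set is complex differentiability at each point. The
   codomain is R[i]^o because R[i] is normed as a module over itself. *)
Definition analytic_on (R : realType) (m : nat) (D : set R[i])
    (F : R[i] -> 'M[R[i]]_m) : Prop :=
  forall z, D z -> forall i j : 'I_m,
    derivable (fun w : R[i]^o => F w i j : R[i]^o) z 1.

Definition nonsingular_on (R : realType) (m : nat) (D : set R[i])
    (F : R[i] -> 'M[R[i]]_m) : Prop :=
  forall z, D z -> \det (F z) != 0.

(* On {|z| > 1} together with the point at infinity: the behaviour at infinity
   is read in the chart w = 1 / z, where L is the value at infinity. *)
Definition analytic_nonsingular_exterior (R : realType) (m : nat)
    (F : R[i] -> 'M[R[i]]_m) : Prop :=
  [/\ analytic_on [set z | 1 < `|z|] F,
      nonsingular_on [set z | 1 < `|z|] F &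
      exists L : 'M[R[i]]_m,
        \det L != 0 /\
        analytic_on [set w | `|w| < 1]
          (fun w => if w == 0 then L else F (1 / w))].

Definition spectral_factor (R : realType) (m N : nat) (C : int -> 'M[R[i]]_m)
    (A : 'I_N.+1 -> 'M[R[i]]_m) : Prop :=
  (forall z : R[i], z != 0 ->
     laurent_mx N C z = poly_mx A z *m para_adj (poly_mx A) z) /\
  nonsingular_on [set z | `|z| < 1] (poly_mx A).

(* Main.v *)
Require Import Defs.
From mathcomp Require Import all_boot all_order all_algebra.
From mathcomp Require Import sesquilinear spectral complex.
From mathcomp Require Import all_classical all_reals all_analysis.
From mathcomp Require Import ring lra zify.

Set Implicit Arguments.
Unset Strict Implicit.
Unset Printing Implicit Defensive.

Import Order.TTheory GRing.Theory Num.Theory.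
Import numFieldNormedType.Exports.
Local Open Scope classical_set_scope.
Local Open Scope sesquilinear_scope.
Local Open Scope ring_scope.

(** Write F~(z) for (F(1/z^* ))^*, which is F(z)^* on the unit circle. The
    proof is algebraic: the factorization is first carried out over rational
    functions, where Gaussian elimination is available, and the poles are then
    removed. Apart from density and sign arguments on the circle, everything
    reduces to roots of polynomials.

    The principle behind the reduction is that a function p(z) z^k (a
    [laurent] function) that vanishes on the circle vanishes on all of C \ {0}
    ([laurent_eq0]), and that products, sums and reflections F |-> F~ of such
    functions are again of this kind. Identities between values on the circle
    can therefore be read at any other point.

    - Scalar case ([fejer_riesz_scalar]). A Laurent polynomial that is
      nonnegative on the circle equals its own reflection, so its roots off the
      circle come in pairs r, 1/r^*; its roots on the circle are at least
      double, since it would change sign at a simple one. In both cases the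
      product of the two linear factors is a constant times z |z - r|^2 on the
      circle, and the degree drops by two.

    - Denominators allowed ([posdefmx_laurent_sqr]). Let a be the upper left
      entry of S and b the rest of its first column. Then
      a S = (a; b)(a; b)^* + 0 (+) (a D - b b^* ), the Schur complement
      a D - b b^* is again positive definite, and a is |f|^2 by the scalar
      case. By induction on the size, |q|^2 S = G G^* on the circle for some
      polynomial q <> 0 and polynomial matrix G.

    - Zeros of G ([outer_factor]). If det G vanishes at r in the disk, say
      G(r) v = 0, multiply G on the right by the Blaschke-Potapov factor that
      is (1 - r^* z)/(z - r) on the line of v and 1 on its orthogonal
      complement. It is unitary on the circle, the product is still polynomial,
      and the zero r of the determinant is replaced by 1/r^*. So G may be
      taken nonsingular in the disk. Likewise the roots of q may be reflected
      out of the disk without changing |q| on the circle ([reflect_roots]).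

    - Cancelling q ([divide_outer]). At a root r of q, the identity
      q q~ S = G G~ gives G(r) G(1/r^* )^* = 0. If |r| > 1, the second factor is
      invertible; if |r| = 1, both factors are adjoint to each other. Either
      way G(r) = 0, so that z - r can be cancelled from q and from G. In the end
      S = G G~ with G a polynomial matrix, nonsingular in the disk.

    - Degree ([size_outer_factor]). If G had degree d > N, the coefficient of
      z^d in G G~ = S would be A_d A_0^* = 0, with A_0 = G(0) invertible.

    - Uniqueness ([outer_factor_unique]). If G1 G1~ = G2 G2~, then
      W = adj(G2) G1 satisfies W W^* = |det G2|^2 on the circle. Cancelling
      det G2 as above, now with S = 1, leaves U with U U^* = 1, and the degree
      bound with N = 0 says that U is constant. *)

(** * Laurent functions on the unit circle *)

(** Nothing is required at 0, where negative powers and reflections across the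
    circle only take conventional values. *)
Definition laurent (C : numClosedFieldType) (F : C -> C) : Prop :=
  exists (p : {poly C}) (k : int), forall z, z != 0 -> F z = p.[z] * z ^ k.

Lemma eq_laurent (C : numClosedFieldType) (F G : C -> C) :
  (forall z, z != 0 -> F z = G z) -> laurent G -> laurent F.
Proof. by move=> FG [p [k pk]]; exists p, k => z z0; rewrite FG ?pk. Qed.

Lemma laurent_horner (C : numClosedFieldType) (p : {poly C}) :
  laurent (horner p).
Proof. by exists p, 0 => z _; rewrite expr0z mulr1. Qed.

Lemma laurent_exprz (C : numClosedFieldType) (k : int) :
  laurent (fun z : C => z ^ k).
Proof. by exists 1, k => z _; rewrite hornerC mul1r. Qed.

Lemma laurentM (C : numClosedFieldType) (F G : C -> C) :
  laurent F -> laurent G -> laurent (fun z => F z * G z).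
Proof.
move=> [p [k pk]] [q [l ql]]; exists (p * q), (k + l) => z z0.
by rewrite pk // ql // hornerM expfzDr // mulrACA.
Qed.

Lemma laurentD (C : numClosedFieldType) (F G : C -> C) :
  laurent F -> laurent G -> laurent (fun z => F z + G z).
Proof.
have aux (p q : {poly C}) (k l : int) (F' G' : C -> C) : k <= l ->
    (forall z, z != 0 -> F' z = p.[z] * z ^ k) ->
    (forall z, z != 0 -> G' z = q.[z] * z ^ l) ->
    laurent (fun z => F' z + G' z).
  move=> kl pk ql; have: 0 <= l - k by rewrite subr_ge0.
  case E: (l - k) => [n|//] _.
  exists (p + q * 'X^n), k => z z0.
  rewrite pk // ql // hornerD hornerM hornerXn mulrDl -mulrA; congr (_ + _ * _).
  by rewrite -[z ^+ n]/(z ^ n%:Z) -E -expfzDr // subrK.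
move=> [p [k pk]] [q [l ql]]; have [kl|/ltW lk] := leP k l.
  exact: aux kl pk ql.
apply: eq_laurent (aux _ _ _ _ _ _ lk ql pk) => z _; exact: addrC.
Qed.

Lemma laurent_cst (C : numClosedFieldType) (c : C) : laurent (fun=> c).
Proof. by exists c%:P, 0 => z _; rewrite hornerC mulr1. Qed.

Lemma laurentN (C : numClosedFieldType) (F : C -> C) :
  laurent F -> laurent (fun z => - F z).
Proof.
move=> lF; apply: eq_laurent (laurentM (laurent_cst (-1)) lF) => z _.
by rewrite mulN1r.
Qed.

Lemma laurentB (C : numClosedFieldType) (F G : C -> C) :
  laurent F -> laurent G -> laurent (fun z => F z - G z).
Proof. by move=> lF lG; apply: laurentD => //; exact: laurentN. Qed.

Lemma laurent_sum (C : numClosedFieldType) (I : Type) (s : seq I)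
    (F : I -> C -> C) :
  (forall i, laurent (F i)) -> laurent (fun z => \sum_(i <- s) F i z).
Proof.
move=> lF; elim: s => [|i s IH].
  by apply: eq_laurent (laurent_cst 0) => z _; rewrite big_nil.
by apply: eq_laurent (laurentD (lF i) IH) => z _; rewrite big_cons.
Qed.

(** The reflection agrees on the circle with the complex conjugate of F, which
    itself is not of the form p(z) z^k off the circle. *)
Lemma laurent_reflect (C : numClosedFieldType) (F : C -> C) :
  laurent F -> laurent (fun z => (F (z^*)^-1)^*).
Proof.
move=> [p [k pk]].
have: laurent (fun z : C =>
    (\sum_(i < size p) (p`_i)^* * z ^ (- i%:Z)) * z ^ (- k)).
  apply: laurentM; last exact: laurent_exprz.
  apply: laurent_sum => i.
  by apply: laurentM; [exact: laurent_cst | exact: laurent_exprz].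
apply: eq_laurent => z z0; rewrite pk ?invr_eq0 ?conjC_eq0 // rmorphM.
rewrite -[X in _ * X]/((((z^*)^-1) ^ k)^*) rmorphXz; last first.
  by rewrite unitfE invr_eq0 conjC_eq0.
rewrite fmorphV /= conjCK exprz_inv; congr (_ * _).
rewrite horner_coef rmorph_sum; apply: eq_bigr => i _ /=.
by rewrite rmorphM rmorphXn fmorphV /= conjCK -exprz_inv.
Qed.

Lemma conj_inv_circle (C : numClosedFieldType) (z : C) :
  `|z| = 1 -> (z^*)^-1 = z.
Proof.
move=> z1; have z0 : z != 0 by rewrite -normr_eq0 z1 oner_eq0.
apply: (mulIf (x := z^*)); first by rewrite conjC_eq0.
by rewrite mulVf ?conjC_eq0 // -normCK z1 expr1n.
Qed.

Lemma circle_neq0 (C : numClosedFieldType) (z : C) : `|z| = 1 -> z != 0.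
Proof. by move=> z1; rewrite -normr_eq0 z1 oner_eq0. Qed.

(** A rational parametrization of the circle minus -1 by the real line. It
    provides infinitely many points of the circle, and points on both sides of
    1, in any numerically closed field. *)
Definition cayley (C : numClosedFieldType) (t : C) : C :=
  (1 + 'i * t) / (1 - 'i * t).

Lemma cayley_den_neq0 (C : numClosedFieldType) (t : C) :
  t \is Num.real -> 1 - 'i * t != 0.
Proof.
move=> tR; apply/eqP => d0.
have : 0 < 1 + t ^+ 2 by rewrite ltr_pwDl ?ltr01 // real_exprn_even_ge0.
suff -> : 1 + t ^+ 2 = (1 - 'i * t) * (1 + 'i * t) by rewrite d0 mul0r ltxx.
by have := sqrCi C => i2; ring: i2.
Qed.

Lemma cayley_circle (C : numClosedFieldType) (t : C) :
  t \is Num.real -> `|cayley t| = 1.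
Proof.
move=> tR; have d0 := cayley_den_neq0 tR.
rewrite normf_div; have -> : 1 + 'i * t = (1 - 'i * t)^*.
  rewrite rmorphB rmorphM /= conjC1 conjCi (CrealP tR) mulNr opprK //.
by rewrite norm_conjC divff // normr_eq0.
Qed.

(** The ratio of z - 1 to i (z + 1) is the real number t, whose sign says on
    which side of 1 the point z of the circle lies. *)
Lemma cayley_sub1 (C : numClosedFieldType) (t : C) :
  t \is Num.real -> cayley t - 1 = 'i * t * (cayley t + 1).
Proof. by move=> tR; have d0 := cayley_den_neq0 tR; rewrite /cayley; field. Qed.

Lemma cayley_near1 (C : numClosedFieldType) (t : C) :
  t \is Num.real -> `|cayley t - 1| <= `|t| * 2.
Proof.
move=> tR; rewrite cayley_sub1 // !normrM normCi mul1r.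
rewrite ler_wpM2l // (le_trans (ler_normD _ _)) // cayley_circle // normr1.
by rewrite -[1]/(1%:R) -natrD.
Qed.

Lemma cayley_inj (C : numClosedFieldType) (s t : C) :
  s \is Num.real -> t \is Num.real -> cayley s = cayley t -> s = t.
Proof.
move=> sR tR; have s0 := cayley_den_neq0 sR; have t0 := cayley_den_neq0 tR.
move/eqP; rewrite /cayley eqr_div // => /eqP E.
have := subrr ((1 + 'i * s) * (1 - 'i * t)); rewrite {2}E.
have -> : (1 + 'i * s) * (1 - 'i * t) - (1 + 'i * t) * (1 - 'i * s) =
  2 * 'i * (s - t) by ring.
by move/eqP; rewrite !mulf_eq0 pnatr_eq0 (negPf (neq0Ci _)) subr_eq0 => /eqP.
Qed.

Lemma poly_circle_eq0 (C : numClosedFieldType) (p : {poly C}) :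
  (forall z, `|z| = 1 -> p.[z] = 0) -> p = 0.
Proof.
move=> p0; pose rs := [seq cayley (n%:R : C) | n <- iota 0 (size p)].
apply: (@roots_geq_poly_eq0 _ p rs).
- apply/allP => _ /mapP[n _ ->]; apply/rootP/p0.
  exact: cayley_circle (realn C n).
- rewrite map_inj_uniq ?iota_uniq // => m n /cayley_inj mn.
  by apply/eqP; rewrite -(eqr_nat C) mn ?realn.
- by rewrite size_map size_iota.
Qed.

(** The factor [p] accounts for finitely many exceptional points of the circle. *)
Lemma laurent_mul_eq0 (C : numClosedFieldType) (p : {poly C}) (F : C -> C) :
  laurent F -> p != 0 -> (forall z, `|z| = 1 -> p.[z] * F z = 0) ->
  forall z, z != 0 -> F z = 0.
Proof.
move=> [f [k fk]] p0 F0 z z0; rewrite fk //.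
have /eqP : p * f = 0.
  apply: poly_circle_eq0 => w w1; have w0 := circle_neq0 w1.
  have /eqP := F0 w w1; rewrite fk // mulrA mulf_eq0 expfz_eq0 (negPf w0) andbF orbF.
  by rewrite hornerM => /eqP.
by rewrite mulf_eq0 (negPf p0) => /eqP ->; rewrite horner0 mul0r.
Qed.

Lemma laurent_eq0 (C : numClosedFieldType) (F : C -> C) :
  laurent F -> (forall z, `|z| = 1 -> F z = 0) -> forall z, z != 0 -> F z = 0.
Proof.
move=> lF F0; apply: (laurent_mul_eq0 lF (oner_neq0 _)) => z z1.
by rewrite F0 ?mulr0.
Qed.

Lemma horner_lipschitz (C : numClosedFieldType) (p : {poly C}) (r : C) :
  exists2 K : C, 0 <= K &
    forall z, `|z| = 1 -> `|p.[z] - p.[r]| <= K * `|z - r|.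
Proof.
have /factor_theorem[q Eq] : root (p - p.[r]%:P) r.
  by rewrite /root hornerD hornerN hornerC subrr.
exists (\sum_(i < size q) `|q`_i|); first by apply: sumr_ge0.
move=> z z1; have -> : p.[z] - p.[r] = q.[z] * (z - r).
  by have := congr1 (horner^~ z) Eq; rewrite hornerD hornerN hornerC hornerM hornerXsubC.
rewrite normrM ler_wpM2r // horner_coef (le_trans (ler_norm_sum _ _ _)) //.
by apply: ler_sum => i _; rewrite normrM normrX z1 expr1n mulr1.
Qed.

(** On the circle 1/z is the conjugate of z, so negative powers are as regular
    as positive ones. *)
Lemma laurent_lipschitz (C : numClosedFieldType) (F : C -> C) (r : C) :
  laurent F -> `|r| = 1 ->
  exists2 K : C, 0 <= K &
    forall z, `|z| = 1 -> `|F z - F r| <= K * `|z - r|.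
Proof.
move=> [p [k pk]] r1; case: k pk => n pk.
  have [K K0 HK] := horner_lipschitz (p * 'X^n) r; exists K => // z z1.
  by have := HK z z1; rewrite !hornerM !hornerXn -!pk ?circle_neq0.
have [K K0 HK] := horner_lipschitz p r.
have [L L0 HL] := horner_lipschitz ('X^(n.+1) : {poly C}) r.
exists (K + `|p.[r]| * L) => [|z z1]; first by rewrite addr_ge0 ?mulr_ge0.
have E w : `|w| = 1 -> F w = p.[w] * (w ^+ n.+1)^*.
  move=> w1; rewrite pk ?circle_neq0 // NegzE -exprnN; congr (_ * _).
  by rewrite rmorphXn /= -exprVn; congr (_ ^+ _); rewrite -{1}(conj_inv_circle w1) invrK.
rewrite !E //.
have -> : p.[z] * (z ^+ n.+1)^* - p.[r] * (r ^+ n.+1)^* =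
    (p.[z] - p.[r]) * (z ^+ n.+1)^* + p.[r] * (z ^+ n.+1 - r ^+ n.+1)^*.
  by rewrite rmorphB /=; ring.
rewrite (le_trans (ler_normD _ _)) // [leRHS]mulrDl lerD //.
  by rewrite normrM norm_conjC normrX z1 expr1n mulr1 HK.
rewrite normrM norm_conjC -mulrA ler_wpM2l //.
by have := HL z z1; rewrite !hornerXn.
Qed.

(** The set of nonnegative numbers is closed: c is at distance at most twice
    its distance to any y >= 0 from `|c|. *)
Lemma laurent_ge0_lim (C : numClosedFieldType) (F : C -> C) (r : C) :
  laurent F -> `|r| = 1 ->
  (forall e, 0 < e -> exists z, [/\ `|z| = 1, `|z - r| < e & 0 <= F z]) ->
  0 <= F r.
Proof.
move=> lF r1 near; have [K K0 HK] := laurent_lipschitz lF r1.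
suff -> : F r = `|F r| by rewrite normr_ge0.
apply/eqP; rewrite -subr_eq0 -normr_eq0; apply/negPn/negP => d0.
set d := `| _ | in d0; have dp : 0 < d by rewrite lt_def d0 normr_ge0.
have K2 : 0 < 2 * K + 1 by rewrite ltr_wpDl ?mulr_ge0.
have [z [z1 zr Fz]] := near (d / (2 * K + 1)) (divr_gt0 dp K2).
have : d <= 2 * `|F z - F r|.
  rewrite /d; have -> : F r - `|F r| = - (F z - F r) + (`|F z| - `|F r|).
    by rewrite (ger0_norm Fz); ring.
  rewrite (le_trans (ler_normD _ _)) // normrN mulr_natl mulr2n lerD2l.
  exact: ler_dist_dist.
apply/negP; rewrite -real_ltNge ?realE ?mulr_ge0 ?(ltW dp) //.
apply: (@le_lt_trans _ _ (2 * (K * `|z - r|))); first by rewrite ler_wpM2l ?HK.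
apply: (@le_lt_trans _ _ (`|z - r| * (2 * K + 1))).
  have -> : `|z - r| * (2 * K + 1) = 2 * (K * `|z - r|) + `|z - r| by ring.
  by rewrite lerDl.
by rewrite -ltr_pdivlMr.
Qed.

(** What is retained of a set of full arc length measure. *)
Definition dense_circle (C : numClosedFieldType) (E : C -> Prop) : Prop :=
  (forall z, E z -> `|z| = 1) /\
  forall r e, `|r| = 1 -> 0 < e -> exists z, E z /\ `|z - r| < e.

Lemma laurent_dense_eq0 (C : numClosedFieldType) (E : C -> Prop) (F : C -> C) :
  dense_circle E -> laurent F -> (forall z, E z -> F z = 0) ->
  forall z, `|z| = 1 -> F z = 0.
Proof.
move=> [E1 Ed] lF F0 r r1; apply/eqP; rewrite eq_le -oppr_ge0; apply/andP; split.
  apply: (laurent_ge0_lim (F := fun z => - F z) (laurentN lF)) => // e e0.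
  have [z [zE zr]] := Ed r e r1 e0; exists z.
  by rewrite F0 // oppr0; split=> //; exact: E1.
apply: laurent_ge0_lim => // e e0.
have [z [zE zr]] := Ed r e r1 e0; exists z.
by rewrite F0 //; split=> //; exact: E1.
Qed.

(** * The scalar Fejer-Riesz theorem *)

Lemma normr_exprz_circle (C : numClosedFieldType) (z : C) (k : int) :
  `|z| = 1 -> `|z ^ k| = 1.
Proof.
move=> z1; case: k => n; first by rewrite normrX z1 expr1n.
by rewrite NegzE -exprnN normfV normrX z1 expr1n invr1.
Qed.

(** The Schwarz reflection principle. *)
Lemma laurent_real_reflect (C : numClosedFieldType) (F : C -> C) :
  laurent F -> (forall z, `|z| = 1 -> F z \is Num.real) ->
  forall z, z != 0 -> F z = (F (z^*)^-1)^*.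
Proof.
move=> lF FR z z0; apply/eqP; rewrite -subr_eq0; apply/eqP; move: z z0.
apply: laurent_eq0 => [|z z1].
  by apply: laurentB => //; exact: laurent_reflect.
by rewrite conj_inv_circle // (CrealP (FR _ z1)) subrr.
Qed.

Lemma circle_approach (C : numClosedFieldType) (r t e : C) :
  `|r| = 1 -> t \is Num.real -> `|t| * 2 < e ->
  `|r * cayley t| = 1 /\ `|r * cayley t - r| < e.
Proof.
move=> r1 tR te; rewrite normrM r1 cayley_circle // mulr1; split=> //.
by rewrite -{2}[r]mulr1 -mulrBr normrM r1 mul1r (le_lt_trans (cayley_near1 tR)).
Qed.

Lemma third_lt (C : numClosedFieldType) (e : C) : 0 < e -> `|e / 3| * 2 < e.
Proof.
move=> e0; rewrite ger0_norm ?divr_ge0 ?ltW // -mulrA gtr_pMr //.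
by rewrite mulrC ltr_pdivrMr // mul1r ltr_nat.
Qed.

(** Sign change: with z = r (1 + it)/(1 - it) the hypothesis reads
    0 <= t * (i (z + r) F(z)), so i (z + r) F(z) is nonnegative for t > 0 and
    nonpositive for t < 0, hence zero in the limit t -> 0. *)
Lemma circle_even_root (C : numClosedFieldType) (F : C -> C) (r : C) :
  laurent F -> `|r| = 1 ->
  (forall z, `|z| = 1 -> 0 <= (z - r) * F z) -> F r = 0.
Proof.
move=> lF r1 F0; pose G z := 'i * (z + r) * F z.
have lG : laurent G.
  apply: laurentM => //; apply: laurentM; first exact: laurent_cst.
  by apply: laurentD; [exists 'X, 0 => z _; rewrite hornerX expr0z mulr1
                      | exact: laurent_cst].
have G0 t : t \is Num.real -> 0 <= t * G (r * cayley t).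
  move=> tR; have := F0 (r * cayley t).
  rewrite normrM r1 cayley_circle // mulr1 => /(_ erefl).
  have -> // : (r * cayley t - r) * F (r * cayley t) = t * G (r * cayley t).
  rewrite /G -{2}[r]mulr1 -mulrBr cayley_sub1 //; ring.
have Gr : 0 <= G r.
  apply: laurent_ge0_lim => // e e0; exists (r * cayley (e / 3)).
  have t0 : 0 < e / 3 by rewrite divr_gt0.
  have [-> ->] := circle_approach r1 (gtr0_real t0) (third_lt e0).
  by rewrite -(pmulr_rge0 _ t0) G0 // gtr0_real.
have NGr : 0 <= - G r.
  apply: (laurent_ge0_lim (F := fun z => - G z) (laurentN lG)) => // e e0.
  exists (r * cayley (- (e / 3))).
  have t0 : 0 < e / 3 by rewrite divr_gt0.
  have tR : - (e / 3) \is Num.real by rewrite realN gtr0_real.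
  have [|-> ->] := @circle_approach C r (- (e / 3)) e r1 tR.
    by rewrite normrN third_lt.
  by rewrite -(pmulr_rge0 _ t0) mulrN -mulNr G0.
have /eqP : G r = 0 by apply/eqP; rewrite eq_le Gr andbT -oppr_ge0.
rewrite /G !mulf_eq0 (negPf (neq0Ci _)) -mulr2n mulrn_eq0 /=.
by rewrite (negPf (circle_neq0 r1)) => /eqP.
Qed.

(** A root r is paired with 1/r^*. This also covers |r| = 1, where the pair is
    a double root. *)
Lemma mul_reflected_factors (C : numClosedFieldType) (r z : C) :
  r != 0 -> `|z| = 1 ->
  (z - r) * (z - (r^*)^-1) = - (r^*)^-1 * z * `|z - r| ^+ 2.
Proof.
move=> r0 z1; rewrite normCK rmorphB /=.
have z0 := circle_neq0 z1.
have zc : z^* = z^-1 by rewrite -{2}(conj_inv_circle z1) invrK.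
have rc0 : r^* != 0 by rewrite conjC_eq0.
by rewrite zc; field; rewrite z0 rc0.
Qed.

(** The exponent k is part of the induction because removing the root 0, or a
    pair r, 1/r^*, shifts it by one. *)
Lemma fejer_riesz_scalar (C : numClosedFieldType) (p : {poly C}) (k : int) :
  p != 0 -> (forall z, `|z| = 1 -> 0 <= p.[z] * z ^ k) ->
  exists f : {poly C}, forall z, `|z| = 1 -> p.[z] * z ^ k = `|f.[z]| ^+ 2.
Proof.
move: {2}(size p) (leqnn (size p)) => n.
elim: n p k => [|n IH] p k; first by rewrite leqn0 size_poly_eq0 => ->.
move=> szp p0 F0; have [sz1|/closed_rootP[r rr]] := boolP (size p == 1)%N.
  have /size_poly1P[c c0 Ep] := sz1.
  exists (sqrtC `|c|)%:P => z z1; rewrite Ep !hornerC.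
  rewrite (ger0_norm (x := sqrtC _)) ?sqrtC_ge0 // sqrtCK.
  have := F0 z z1; rewrite Ep hornerC => /ger0_norm <-.
  by rewrite normrM normr_exprz_circle // mulr1.
have /factor_theorem[q Eq] := rr.
have q0 : q != 0 by apply: contraNneq p0 => q0; rewrite Eq q0 mul0r.
have szq : size p = (size q).+1.
  by rewrite Eq size_Mmonic ?monicXsubC // size_XsubC addn2.
have [r0|r0] := eqVneq r 0.
  have E z : `|z| = 1 -> p.[z] * z ^ k = q.[z] * z ^ (k + 1).
    move=> z1; rewrite Eq hornerM hornerXsubC r0 subr0 addrC expfzDr ?circle_neq0 //.
    by rewrite mulrA.
  have [||f Ef] := IH q (k + 1) _ q0.
  - by rewrite -ltnS -szq.
  - by move=> z z1; rewrite -E // F0.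
  by exists f => z z1; rewrite E // Ef.
have rc0 : r^* != 0 by rewrite conjC_eq0.
have lF : laurent (fun z => p.[z] * z ^ k) by exists p, k.
(* The partner of r is a root of the remaining factor, whether it is another
   point (reflection) or r itself (no sign change). *)
have qr' : root q (r^*)^-1.
  have [r1|r1] := eqVneq `|r| 1.
    rewrite conj_inv_circle //.
    have : q.[r] * r ^ k = 0.
      apply: (circle_even_root (F := fun z => q.[z] * z ^ k)) => //.
        by exists q, k.
      move=> z z1; have := F0 z z1; rewrite Eq hornerM hornerXsubC.
      by rewrite mulrAC mulrC.
    move/eqP; rewrite mulf_eq0 => /orP[//|].
    by rewrite expfz_eq0 (negPf r0) andbF.
  have /eqP := laurent_real_reflect lF (fun z z1 => ger0_real (F0 z z1)) r0.
  rewrite (rootP rr) mul0r eq_sym conjC_eq0 mulf_eq0 expfz_eq0.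
  have /negPf-> : (r^*)^-1 != 0 by rewrite invr_eq0.
  rewrite andbF orbF Eq hornerM hornerXsubC mulf_eq0 => /orP[//|].
  rewrite subr_eq0 => /eqP E; case/negP: r1.
  rewrite -(@eqrXn2 _ 2) // normCK expr1n -{1}E mulVf //.
have /factor_theorem[s Es] := qr'.
have szs : size q = (size s).+1.
  rewrite Es size_Mmonic ?monicXsubC ?size_XsubC ?addn2 //.
  by apply: contraNneq q0 => s0; rewrite Es s0 mul0r.
pose g := - (r^*)^-1 *: s.
have a0 : - (r^*)^-1 != 0 by rewrite oppr_eq0 invr_eq0.
have E z : `|z| = 1 -> p.[z] * z ^ k = `|z - r| ^+ 2 * (g.[z] * z ^ (k + 1)).
  move=> z1; rewrite Eq Es !hornerM !hornerXsubC -mulrA [_ * (z - r)]mulrC.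
  rewrite mul_reflected_factors // hornerZ addrC expfzDr ?circle_neq0 // expr1z.
  ring.
(* Dividing by |z - r|^2 leaves out z = r, which is recovered as a limit. *)
have g0 z : `|z| = 1 -> 0 <= g.[z] * z ^ (k + 1).
  have H w : `|w| = 1 -> w != r -> 0 <= g.[w] * w ^ (k + 1).
    move=> w1 wr; rewrite -(@pmulr_rge0 _ (`|w - r| ^+ 2)) -?E ?F0 //.
    by rewrite exprn_gt0 // normr_gt0 subr_eq0.
  move=> z1; have [zr|] := eqVneq z r; last exact: H.
  rewrite -zr in H *; apply: (laurent_ge0_lim (F := fun z => g.[z] * z ^ (k + 1))).
  - by exists g, (k + 1).
  - by [].
  move=> e e0; exists (z * cayley (e / 3)).
  have t0 : 0 < e / 3 by rewrite divr_gt0.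
  have [|c1 ->] := @circle_approach C z _ e z1 (gtr0_real t0).
    exact: third_lt.
  rewrite c1; split=> //; apply: H => //.
  rewrite -{2}[z]mulr1 -subr_eq0 -mulrBr mulf_eq0 (negPf (circle_neq0 z1)) /=.
  rewrite subr_eq0; apply: contraTneq t0 => c1'.
  suff -> : e / 3 = 0 by rewrite ltxx.
  apply: cayley_inj; rewrite ?real0 ?gtr0_real ?divr_gt0 // c1'.
  by rewrite /cayley mulr0 addr0 subr0 divr1.
have [|||f Ef] := IH g (k + 1).
- by rewrite size_scale // -ltnS -szs (leq_trans _ szp) // szq.
- by rewrite scaler_eq0 (negPf a0) /=; apply: contraNneq q0 => s0; rewrite Es s0 mul0r.
- exact: g0.
exists (f * ('X - r%:P)) => z z1.
by rewrite E // Ef // hornerM hornerXsubC normrM exprMn mulrC.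
Qed.

(** * Adjoints and values of matrix polynomials *)

Lemma ctmxM (C : numClosedFieldType) m n p (A : 'M[C]_(m, n)) (B : 'M[_]_(n, p)) :
  (A *m B)^t* = B^t* *m A^t*.
Proof. by rewrite trmx_mul map_mxM. Qed.

Lemma ctmxK (C : numClosedFieldType) m n (A : 'M[C]_(m, n)) : A^t*^t* = A.
Proof. by apply/matrixP => i j; rewrite !mxE; exact: conjCK. Qed.

Lemma ctmxZ (C : numClosedFieldType) m n (a : C) (A : 'M[C]_(m, n)) :
  (a *: A)^t* = a^* *: A^t*.
Proof. by apply/matrixP => i j; rewrite !mxE; exact: rmorphM. Qed.

Lemma ctmxD (C : numClosedFieldType) m n (A B : 'M[C]_(m, n)) :
  (A + B)^t* = A^t* + B^t*.
Proof. by apply/matrixP => i j; rewrite !mxE; exact: rmorphD. Qed.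

Lemma ctmxN (C : numClosedFieldType) m n (A : 'M[C]_(m, n)) :
  (- A)^t* = - A^t*.
Proof. by apply/matrixP => i j; rewrite !mxE; exact: rmorphN. Qed.

Lemma ctmx_scalar (C : numClosedFieldType) n (a : C) :
  (a%:M : 'M[_]_n)^t* = (a^*)%:M.
Proof. by rewrite tr_scalar_mx map_scalar_mx. Qed.

Lemma det_ctmx (C : numClosedFieldType) n (A : 'M[C]_n) :
  \det (A^t*) = (\det A)^*.
Proof. by rewrite det_map_mx det_tr. Qed.

Local Notation "G .@[ z ]" := (map_mx (horner_eval z) G)
  (at level 1, left associativity, format "G .@[ z ]") : ring_scope.

Lemma det_at (C : numClosedFieldType) m (G : 'M[{poly C}]_m) z :
  \det G.@[z] = (\det G).[z].
Proof. by rewrite det_map_mx. Qed.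

Lemma mx_atM (C : comNzRingType) m n p (A : 'M[{poly C}]_(m, n)) (B : 'M[_]_(n, p)) z :
  (A *m B).@[z] = A.@[z] *m B.@[z].
Proof. exact: map_mxM. Qed.

Lemma mx_atD (C : comNzRingType) m n (A B : 'M[{poly C}]_(m, n)) z :
  (A + B).@[z] = A.@[z] + B.@[z].
Proof. exact: map_mxD. Qed.

Lemma mx_atB (C : comNzRingType) m n (A B : 'M[{poly C}]_(m, n)) z :
  (A - B).@[z] = A.@[z] - B.@[z].
Proof. exact: map_mxB. Qed.

Lemma mx_atZ (C : comNzRingType) m n p (A : 'M[{poly C}]_(m, n)) z :
  (p *: A).@[z] = p.[z] *: A.@[z].
Proof. exact: map_mxZ. Qed.

Lemma mx_atC (C : comNzRingType) m n (A : 'M[C]_(m, n)) z :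
  (map_mx polyC A).@[z] = A.
Proof. by apply/matrixP => i j; rewrite !mxE /horner_eval hornerC. Qed.

Lemma ctmx_form_gt0 (C : numClosedFieldType) m (v : 'cV[C]_m) :
  v != 0 -> 0 < (v^t* *m v) 0 0.
Proof.
move=> v0; have E : (v^t* *m v) 0 0 = \sum_i `|v i 0| ^+ 2.
  by rewrite mxE; apply: eq_bigr => i _; rewrite !mxE normCKC.
rewrite E lt_def sumr_ge0 => [|i _]; last exact: exprn_ge0.
rewrite andbT psumr_eq0 => [|i _]; last exact: exprn_ge0.
apply: contraNN v0 => /allP H; apply/eqP/matrixP => i j; rewrite ord1 mxE.
have := H i; rewrite mem_index_enum expf_eq0 normr_eq0 => /(_ isT) /=.
by move/eqP.
Qed.

Lemma mul_ctmx_eq0 (C : numClosedFieldType) m n (A : 'M[C]_(m, n)) :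
  A *m A^t* = 0 -> A = 0.
Proof.
move=> A0; apply/row_matrixP => i; rewrite row0; apply/eqP/negPn/negP => ri.
have /ctmx_form_gt0 : (row i A)^t* != 0.
  by apply: contraNneq ri => E; rewrite -[row i A]ctmxK E trmx0 map_mx0.
rewrite ctmxK; suff -> : (row i A *m (row i A)^t*) 0 0 = (A *m A^t*) i i.
  by rewrite A0 mxE ltxx.
by rewrite !mxE; apply: eq_bigr => j _; rewrite !mxE.
Qed.

(** * Positive definite Laurent matrices as quotients of squares *)

(** For x <> 0, the vector (- b^* x; a x) turns the form of the block matrix
    into a times the form of the Schur complement at x. Scaling by a rather
    than dividing by it keeps polynomial entries polynomial. *)
Lemma posdefmx_schur (R : realType) (m : nat) (a : R[i]) (b' : 'rV_m)
    (b : 'cV_m) (D : 'M[_]_m) :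
  posdefmx (block_mx a%:M b' b D : 'M[_]_(1 + m)) ->
  [/\ 0 < a, b' = b^t* & posdefmx (a *: D - b *m b')].
Proof.
move=> [/is_hermitianmxP]; rewrite expr0 scale1r tr_block_mx map_block_mx.
move=> /eq_block_mx[_ Eb' _ ED] pos.
have a0 : 0 < a.
  have := pos (col_mx 1%:M 0); rewrite tr_col_mx map_row_mx mul_row_block.
  rewrite mul_row_col ctmx_scalar conjC1 !mul1mx trmx0 map_mx0 !mul0mx !addr0.
  rewrite mulmx0 addr0 mulmx1 mxE eqxx mulr1n; apply.
  by apply/eqP => /matrixP/(_ (lshift m 0) 0)/eqP; rewrite col_mxEu !mxE eqxx oner_eq0.
have aC : a^* = a by apply/CrealP; exact: gtr0_real.
split=> //; split.
  apply/is_hermitianmxP; rewrite expr0 scale1r ctmxD ctmxN ctmxZ ctmxM aC.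
  by rewrite -ED Eb' ctmxK.
move=> x x0; rewrite -(pmulr_rgt0 _ a0).
have := pos (col_mx (- (b' *m x)) (a *: x)).
have -> : (col_mx (- (b' *m x)) (a *: x))^t* = row_mx (- (x^t* *m b)) (a *: x^t*).
  by rewrite tr_col_mx map_row_mx ctmxN ctmxM ctmxZ aC Eb' ctmxK.
rewrite mul_row_block mul_row_col mul_mx_scalar -scalemxAl scalerN addNr mul0mx add0r.
have -> : - (x^t* *m b) *m b' + a *: x^t* *m D = x^t* *m (a *: D - b *m b').
  by rewrite mulmxBr -scalemxAr -scalemxAl mulmxA mulNmx addrC.
rewrite -scalemxAr mxE.
apply; apply: contraNneq x0 => /eqP.
by rewrite col_mx_eq0 scaler_eq0 (gt_eqF a0) => /andP[_].
Qed.

(** The set E is arbitrary because positivity is only known almost everywhere;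
    carrying E through the induction avoids discussing where the leading
    entries of the successive Schur complements vanish. *)
Lemma posdefmx_laurent_sqr (R : realType) (E : R[i] -> Prop) (m : nat) (k : int)
    (P : 'M[{poly R[i]}]_m) :
  dense_circle E -> (forall z, E z -> posdefmx (z ^ k *: P.@[z])) ->
  exists (q : {poly R[i]}) (G : 'M[_]_m), q != 0 /\
    forall z, E z ->
      `|q.[z]| ^+ 2 *: (z ^ k *: P.@[z]) = G.@[z] *m (G.@[z])^t*.
Proof.
move=> [E1 Ed]; elim: m k P => [|m IH] k.
  move=> P _; exists 1, 0; split=> [|z _]; first exact: oner_neq0.
  by rewrite [LHS]flatmx0 [RHS]flatmx0.
rewrite -[m.+1]/(1 + m)%N => P posP.
pose a := P 0 0; pose b' := ursubmx P; pose b := dlsubmx P; pose D := drsubmx P.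
have Ea : ulsubmx P = a%:M.
  by rewrite [LHS]mx11_scalar !mxE; congr (P _ _)%:M; apply: val_inj.
have EP : P = block_mx a%:M b' b D by rewrite -Ea; exact: esym (submxK P).
have Ez z : z ^ k *: P.@[z] =
    block_mx (a.[z] * z ^ k)%:M (z ^ k *: b'.@[z]) (z ^ k *: b.@[z]) (z ^ k *: D.@[z]).
  by rewrite EP map_block_mx scale_block_mx map_scalar_mx /= scale_scalar_mx mulrC.
have Es z : `|z| = 1 -> z ^ (k + k) *: (a *: D - b *m b').@[z] =
    a.[z] * z ^ k *: (z ^ k *: D.@[z]) - z ^ k *: b.@[z] *m (z ^ k *: b'.@[z]).
  move=> z1; rewrite map_mxB map_mxM map_mxZ /=.
  rewrite -scalemxAl -scalemxAr !scalerA scalerBr scalerA expfzDr ?circle_neq0 //.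
  by congr (_ *: _ - _); rewrite mulrC mulrA.
have sch z : E z -> [/\ 0 < a.[z] * z ^ k, z ^ k *: b'.@[z] = (z ^ k *: b.@[z])^t*
    & posdefmx (z ^ (k + k) *: (a *: D - b *m b').@[z])].
  move=> zE; have := posP z zE; rewrite Ez => /posdefmx_schur[? ? ?]; split => //.
  by rewrite Es ?E1.
have [q [G [q0 EG]]] := IH (k + k) _ (fun z zE => let: And3 _ _ h := sch z zE in h).
have a0 : a != 0.
  have [z [/sch[az _ _] _]] := Ed 1 1 (normr1 _) ltr01.
  by apply: contraTneq az => ->; rewrite horner0 mul0r ltxx.
have [|f Ef] := @fejer_riesz_scalar _ a k a0.
  move=> r r1; apply: (laurent_ge0_lim (F := fun z => a.[z] * z ^ k)) => //.
    by exists a, k.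
  move=> e e0; have [z [zE zr]] := Ed r e r1 e0; exists z; rewrite E1 //.
  by have [/ltW] := sch z zE.
(* The first block column is q (a; b), the second one factors the Schur
   complement; the scalar |q|^2 a in front of S is |q f|^2. *)
exists (q * f), (block_mx (q * a)%:M 0 (q *: b) G); split.
  rewrite mulf_neq0 //; have [z [/[dup]zE/sch[az _ _] _]] := Ed 1 1 (normr1 _) ltr01.
  apply: contraTneq az => f0.
  by rewrite (Ef _ (E1 _ zE)) f0 horner0 normr0 expr0n ltxx.
move=> z zE; have [az Eb _] := sch z zE; have z1 := E1 z zE.
have aC : (a.[z] * z ^ k)^* = a.[z] * z ^ k by apply/CrealP; exact: gtr0_real.
have u1 : z ^ k * (z ^ k)^* = 1 by rewrite -normCK normr_exprz_circle ?expr1n.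
have := EG z zE; rewrite hornerM normrM exprMn -(Ef z z1) Ez (Es z z1) Eb.
rewrite ctmxZ; set u := z ^ k in u1 aC *; set al := a.[z] * u in aC *.
have alu : al * u^* = a.[z] by rewrite /al -mulrA u1 mulr1.
have alu' : al * u = (a.[z])^* by rewrite -alu rmorphM /= conjCK aC.
move=> EG'; rewrite map_block_mx tr_block_mx map_block_mx mulmx_block.
rewrite map_mx0 trmx0 map_mx0 !mul0mx !mulmx0 !addr0 map_scalar_mx ctmx_scalar /=.
rewrite map_mxZ /= /horner_eval hornerM ctmxZ -EG' scale_block_mx; congr block_mx.
- rewrite -scalar_mxM scale_scalar_mx; apply: congr1.
  by rewrite rmorphM /= normCK -alu' -alu; ring: u1.
- rewrite mul_scalar_mx !scalerA; congr (_ *: _).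
  by rewrite normCK -alu; ring.
- rewrite mul_mx_scalar !scalerA; congr (_ *: _).
  by rewrite normCK rmorphM /= -alu'; ring.
- rewrite -!scalemxAl -!scalemxAr !scalerA u1 scale1r scalerBr !scalerA normCK.
  by rewrite -!mulrA /horner_eval [RHS]addrC subrK.
Qed.

(** * Moving the zeros out of the disk *)

Lemma reflected_factor_neq0 (C : numClosedFieldType) (r z : C) :
  `|r| <= 1 -> `|z| < 1 -> 1 - r^* * z != 0.
Proof.
move=> r1 z1; rewrite subr_eq0; apply/eqP => /(congr1 Num.norm).
rewrite normr1 normrM norm_conjC => E.
have : `|r| * `|z| < 1 by apply: le_lt_trans z1; rewrite ler_piMl.
by rewrite -E ltxx.
Qed.

Definition nonsingular_disk (C : numClosedFieldType) m (G : 'M[{poly C}]_m) :=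
  forall z, `|z| < 1 -> \det G.@[z] != 0.

(** Sylvester's determinant identity, from the two triangular factorizations of
    the block matrix (1, -u; v, 1). *)
Lemma det_1D_mulmxC (A : comNzRingType) m n (u : 'M[A]_(m, n)) (v : 'M[_]_(n, m)) :
  \det (1%:M + u *m v) = \det (1%:M + v *m u).
Proof.
have E : block_mx 1%:M 0 v 1%:M *m block_mx 1%:M (- u) 0 (1%:M + v *m u) =
    block_mx (1%:M + u *m v) (- u) 0 1%:M *m block_mx 1%:M 0 v 1%:M.
  rewrite !mulmx_block !mul1mx !mulmx1 !mul0mx !mulmx0 !addr0 !add0r mulNmx mulmxN.
  by rewrite addrK addrC addrK.
have := congr1 determinant E; rewrite !det_mulmx !det_lblock !det_ublock !det1.
by rewrite !mul1r !mulr1 => ->.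
Qed.

Lemma mx_dvd_XsubC (C : numClosedFieldType) m n (G : 'M[{poly C}]_(m, n)) r :
  G.@[r] = 0 -> exists H : 'M[_]_(m, n), G = ('X - r%:P) *: H.
Proof.
move=> G0; exists (map_mx (fun p => p %/ ('X - r%:P)) G).
apply/matrixP => i j; rewrite !mxE mulrC divpK // dvdp_XsubCl.
by apply/rootP; have /matrixP/(_ i j) := G0; rewrite !mxE.
Qed.

(** The new matrix is G (1 - vw + ((1 - r^* z)/(z - r)) vw), where G(r) v = 0 and
    vw is the orthogonal projection onto the line of v. The division is exact
    since G v vanishes at r. *)
Lemma blaschke_potapov (C : numClosedFieldType) m (G : 'M[{poly C}]_m) r :
  root (\det G) r ->
  exists G' : 'M[{poly C}]_m,
    (forall z, `|z| = 1 -> z != r ->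
       G'.@[z] *m (G'.@[z])^t* = G.@[z] *m (G.@[z])^t*) /\
    \det G' * ('X - r%:P) = \det G * (1 - r^* *: 'X).
Proof.
move=> rG.
have [v v0 Gv] : exists2 v : 'cV_m, v != 0 & G.@[r] *m v = 0.
  have /eqP/det0P[w w0 wG] : \det (G.@[r]^T) = 0 by rewrite det_tr det_at (rootP rG).
  exists w^T; first by rewrite -(inj_eq trmx_inj) trmxK trmx0.
  by apply: trmx_inj; rewrite trmx_mul trmxK wG trmx0.
have [w wv hvw] : exists2 w : 'rV_m, w *m v = 1%:M & (v *m w)^t* = v *m w.
  pose s := (v^t* *m v) 0 0; have s0 : 0 < s by exact: ctmx_form_gt0.
  have sC : (s^-1)^* = s^-1 by apply/CrealP; rewrite realV gtr0_real.
  exists (s^-1 *: v^t*).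
    by rewrite -scalemxAl [_ *m v]mx11_scalar scale_scalar_mx mulVf ?gt_eqF.
  by rewrite ctmxM ctmxZ ctmxK sC -scalemxAl scalemxAr.
pose V := map_mx polyC v; pose W := map_mx polyC w.
have WV : W *m V = 1%:M by rewrite -map_mxM wv map_mx1.
have [H EH] : exists H, G *m V = ('X - r%:P) *: H.
  by apply: mx_dvd_XsubC; rewrite mx_atM mx_atC.
pose b : {poly C} := 1 - r^* *: 'X; pose c : {poly C} := 'X - r%:P.
pose G' := G - G *m V *m W + b *: (H *m W).
have G'V : G' *m V = b *: H.
  by rewrite mulmxDl mulmxBl -!mulmxA -scalemxAl -mulmxA WV !mulmx1 subrr add0r.
exists G'; split=> [z z1 zr|].
  have zr0 : z - r != 0 by rewrite subr_eq0.
  pose beta := (1 - r^* * z) / (z - r).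
  have bb : beta * beta^* = 1.
    rewrite -normCK normf_div.
    have -> : 1 - r^* * z = z * (z - r)^*.
      by rewrite rmorphB /= mulrBr -normCK z1 expr1n mulrC.
    by rewrite normrM z1 mul1r norm_conjC divff ?normr_eq0 ?expr1n.
  have GvE : G.@[z] *m v = (z - r) *: H.@[z].
    have := congr1 (fun A => A.@[z]) EH; rewrite mx_atM mx_atC => ->.
    by rewrite mx_atZ hornerXsubC.
  pose B := 1%:M + (beta - 1) *: (v *m w).
  have -> : G'.@[z] = G.@[z] *m B.
    rewrite mx_atD mx_atB mx_atZ !mx_atM !mx_atC.
    rewrite mulmxDr mulmx1 -addrA; congr (_ + _).
    rewrite -scalemxAr mulmxA GvE -!scalemxAl scalerA mulrBl divfK // mul1r.
    by rewrite addrC -scalerBl /b !hornerE.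
  rewrite ctmxM -mulmxA [B *m _]mulmxA; suff -> : B *m B^t* = 1%:M by rewrite mul1mx.
  rewrite /B ctmxD ctmxZ hvw ctmx_scalar conjC1 mulmxDl mul1mx mulmxDr mulmx1 -addrA.
  rewrite -[RHS]addr0; congr (_ + _).
  rewrite -scalemxAl -scalemxAr -mulmxA [w *m _]mulmxA wv mul1mx !scalerA -!scalerDl.
  have -> : (beta - 1)^* + (beta - 1 + (beta - 1) * (beta - 1)^*) = beta * beta^* - 1.
    by rewrite rmorphB /= conjC1; ring.
  by rewrite bb subrr scale0r.
(* G' is G times the Blaschke-Potapov factor; clearing its denominator turns
   this into an identity of polynomial matrices, whose determinant is the
   claim. *)
have E : G' *m (1%:M + (c - 1) *: V *m W) = G *m (1%:M + (b - 1) *: V *m W).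
  rewrite !mulmxDr !mulmx1 !mulmxA -!scalemxAr G'V EH -!scalemxAl /G' EH -!scalemxAl -/c.
  rewrite !scalerA -!addrA; congr (_ + _); rewrite -scaleNr -!scalerDl.
  by congr (_ *: _); rewrite /b /c -mul_polyC; ring.
have d1 (x : {poly C}) : \det (1%:M + (x - 1) *: V *m W) = x.
  rewrite det_1D_mulmxC -scalemxAr WV scale_scalar_mx -raddfD /= det_scalar1.
  by rewrite mulr1 addrC subrK.
by have := congr1 determinant E; rewrite !det_mulmx !d1.
Qed.

(** Induction on the roots of det G: each root in the disk is moved out by a
    Blaschke-Potapov factor, which leaves the other roots in place. The
    cofactor h collects the roots already outside. *)
Lemma outer_factor (C : numClosedFieldType) m (G : 'M[{poly C}]_m) :
  \det G != 0 ->
  exists G' : 'M[{poly C}]_m,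
    (forall z, `|z| = 1 -> G'.@[z] *m (G'.@[z])^t* = G.@[z] *m (G.@[z])^t*) /\
    nonsingular_disk G'.
Proof.
move=> G0; have [s Es] := closed_field_poly_normal (\det G).
have lc0 : lead_coef (\det G) != 0 by rewrite lead_coef_eq0.
have : exists2 h : {poly C}, \det G = h * \prod_(x <- s) ('X - x%:P) &
    forall z, `|z| < 1 -> h.[z] != 0.
  by exists (lead_coef (\det G))%:P; rewrite ?mul_polyC // => z _; rewrite hornerC.
elim: s G {G0 Es lc0} => [|r s IH] G [h Eh h0].
  exists G; split=> // z z1; rewrite det_at Eh big_nil mulr1; exact: h0.
rewrite big_cons in Eh.
have [r1|r1] := boolP (`|r| < 1); last first.
  apply: IH; exists (h * ('X - r%:P)); first by rewrite Eh mulrA.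
  move=> z z1; rewrite hornerM mulf_neq0 ?h0 // hornerXsubC subr_eq0.
  by apply: contraNneq r1 => <-.
have rG : root (\det G) r.
  by rewrite /root Eh !hornerM hornerXsubC subrr mul0r mulr0.
have [G1 [E1 D1]] := blaschke_potapov rG.
have [|G' [E' D']] := IH G1.
  exists (h * (1 - r^* *: 'X)).
    apply: (mulIf (x := 'X - r%:P)); first by rewrite polyXsubC_eq0.
    rewrite D1 Eh; ring.
  move=> z z1; rewrite hornerM mulf_neq0 ?h0 // !hornerE.
  by rewrite reflected_factor_neq0 // ltW.
exists G'; split=> // z z1; rewrite E' // E1 //.
by apply: contraTneq r1 => <-; rewrite z1 ltxx.
Qed.

(** On the circle |1 - r^* z| = |z - r|, so a root r of the disk can be traded
    for 1/r^*. *)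
Lemma reflect_roots (C : numClosedFieldType) (q : {poly C}) :
  q != 0 -> exists q' : {poly C},
    (forall z, `|z| = 1 -> `|q'.[z]| = `|q.[z]|) /\
    (forall z, `|z| < 1 -> q'.[z] != 0).
Proof.
move=> q0; have [s ->] := closed_field_poly_normal q.
have lc0 : lead_coef q != 0 by rewrite lead_coef_eq0.
move: (lead_coef q) lc0 => c c0; elim: s => [|r s [q' [E' D']]].
  by exists (c *: 1); rewrite big_nil; split=> // z _; rewrite hornerZ hornerC mulr1.
have [r1|r1] := boolP (`|r| < 1); last first.
  exists (q' * ('X - r%:P)); split=> z z1.
    by rewrite big_cons scalerAr hornerM normrM E' // -normrM -hornerM mulrC.
  rewrite hornerM mulf_neq0 ?D' // hornerXsubC subr_eq0.
  by apply: contraNneq r1 => <-.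
exists (q' * (1 - r^* *: 'X)); split=> z z1; last first.
  by rewrite hornerM mulf_neq0 ?D' // !hornerE reflected_factor_neq0 // ltW.
rewrite big_cons scalerAr mulrC !hornerM !normrM E' // mulrC [RHS]mulrC.
congr (_ * _); rewrite !hornerE.
have -> : 1 - r^* * z = z * (z - r)^*.
  by rewrite rmorphB /= mulrBr -normCK z1 expr1n mulrC.
by rewrite normrM z1 mul1r norm_conjC.
Qed.

(** * Cancelling the denominator *)

Lemma laurent_mulmx_ct (C : numClosedFieldType) m (G H : 'M[{poly C}]_m) i j :
  laurent (fun z => (G.@[z] *m (H.@[(z^*)^-1])^t*) i j).
Proof.
have: laurent (fun z => \sum_l (G i l).[z] * ((H j l).[(z^*)^-1])^*).
  apply: laurent_sum => l; apply: laurentM; first exact: laurent_horner.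
  exact/laurent_reflect/laurent_horner.
by apply: eq_laurent => z _; rewrite mxE; apply: eq_bigr => l _; rewrite !mxE.
Qed.

(** The difference of the two sides of |q|^2 S = G G^*, written without absolute
    value so that it makes sense, and vanishes, off the circle as well. *)
Lemma laurent_defect (C : numClosedFieldType) m (S : C -> 'M[C]_m)
    (q : {poly C}) (G : 'M[{poly C}]_m) i j :
  (forall i j, laurent (fun z => S z i j)) ->
  laurent (fun z => q.[z] * (q.[(z^*)^-1])^* * S z i j
                    - (G.@[z] *m (G.@[(z^*)^-1])^t*) i j).
Proof.
move=> lS; apply: laurentB; last exact: laurent_mulmx_ct.
apply: laurentM => //; apply: laurentM; first exact: laurent_horner.
exact/laurent_reflect/laurent_horner.
Qed.

(** If |r| > 1, then 1/r^* lies in the disk and G(1/r^* ) is invertible; if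
    |r| = 1, then 1/r^* = r. In both cases G(r) G(1/r^* )^* = 0 forces
    G(r) = 0. *)
Lemma divide_linear_factor (C : numClosedFieldType) m (S : C -> 'M[C]_m)
    (q : {poly C}) (G : 'M[{poly C}]_m) (r : C) :
  (forall i j, laurent (fun z => S z i j)) -> nonsingular_disk G -> 1 <= `|r| ->
  (forall z, `|z| = 1 ->
     `|(('X - r%:P) * q).[z]| ^+ 2 *: S z = G.@[z] *m (G.@[z])^t*) ->
  exists2 G1 : 'M[{poly C}]_m, G = ('X - r%:P) *: G1 &
    forall z, `|z| = 1 -> `|q.[z]| ^+ 2 *: S z = G1.@[z] *m (G1.@[z])^t*.
Proof.
move=> lS nsG r1 EG; have r0 : r != 0.
  by apply: contraTneq r1 => ->; rewrite normr0 ler10.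
(* The identity q q~ S = G G~, known on the circle, read at the root r of q. *)
have prod0 : G.@[r] *m (G.@[(r^*)^-1])^t* = 0.
  apply/matrixP => i j; rewrite [RHS]mxE; apply/eqP; rewrite -oppr_eq0; apply/eqP.
  have := laurent_eq0 (laurent_defect (('X - r%:P) * q) G i j lS) _ r0.
  rewrite {1}hornerM hornerXsubC subrr !mul0r add0r; apply=> z z1.
  have /matrixP/(_ i j) := EG z z1; rewrite [LHS]mxE conj_inv_circle // => <-.
  by rewrite -normCK subrr.
have Gr : G.@[r] = 0.
  have [r1'|r1'] := eqVneq `|r| 1.
    by apply: mul_ctmx_eq0; rewrite -{2}(conj_inv_circle r1').
  have: (G.@[(r^*)^-1])^t* \in unitmx.
    rewrite unitmxE unitfE det_ctmx conjC_eq0 nsG // normfV norm_conjC.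
    by rewrite invf_lt1 ?normr_gt0 // lt_def r1'.
  by move=> u; rewrite -[LHS](mulmxK u) prod0 mul0mx.
have [G1 EG1] := mx_dvd_XsubC Gr; exists G1 => // z z1.
apply/matrixP => i j; rewrite [LHS]mxE; apply/eqP; rewrite -subr_eq0; apply/eqP.
have Xr0 : 'X - r%:P != 0 by rewrite polyXsubC_eq0.
have := laurent_mul_eq0 (laurent_defect q G1 i j lS) Xr0 _ (circle_neq0 z1).
rewrite conj_inv_circle // -normCK; apply=> w w1.
rewrite conj_inv_circle // -normCK hornerXsubC.
have [->|wr] := eqVneq w r; first by rewrite subrr mul0r.
have wr0 : `|w - r| ^+ 2 != 0 by rewrite expf_eq0 normr_eq0 subr_eq0.
apply/eqP; rewrite mulf_eq0 subr_eq0 (negPf wr) /= -(mulrI_eq0 _ (mulfI wr0)).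
have := EG w w1; rewrite EG1 mx_atZ ctmxZ -scalemxAl -scalemxAr scalerA -normCK.
rewrite hornerM hornerXsubC normrM exprMn -scalerA => /(scalerI wr0)/matrixP/(_ i j).
by rewrite [LHS]mxE => ->; rewrite subrr mulr0.
Qed.

(** The factor of S is the quotient of G itself, not a new matrix: uniqueness
    needs this. *)
Lemma divide_outer (C : numClosedFieldType) m (S : C -> 'M[C]_m)
    (q : {poly C}) (G : 'M[{poly C}]_m) :
  (forall i j, laurent (fun z => S z i j)) -> nonsingular_disk G ->
  (forall z, `|z| < 1 -> q.[z] != 0) ->
  (forall z, `|z| = 1 -> `|q.[z]| ^+ 2 *: S z = G.@[z] *m (G.@[z])^t*) ->
  exists G' : 'M[{poly C}]_m, [/\ G = q *: G', nonsingular_disk G' &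
    forall z, `|z| = 1 -> S z = G'.@[z] *m (G'.@[z])^t*].
Proof.
move=> lS nsG nsq EG.
suff [G' EG' ES] : exists2 G', G = q *: G' &
    forall z, `|z| = 1 -> S z = G'.@[z] *m (G'.@[z])^t*.
  exists G'; split=> // z z1; have := nsG z z1; rewrite EG' mx_atZ detZ.
  by rewrite mulf_eq0 negb_or => /andP[].
have q0 : q != 0.
  by apply: contraNneq (nsq 0 _) => [->|]; rewrite ?horner0 // normr0 ltr01.
have [s Es] := closed_field_poly_normal q.
have lc0 : lead_coef q != 0 by rewrite lead_coef_eq0.
move: (lead_coef q) lc0 Es => c c0 Es; rewrite {q0}Es in nsq EG *.
elim: s G nsG nsq EG => [|r s IH] G nsG nsq EG.
  exists (c^-1%:P *: G).
    by rewrite big_nil scalerA -mul_polyC mulr1 -polyCM divff // scale1r.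
  move=> z z1; have := EG z z1; rewrite big_nil hornerZ hornerC mulr1 mx_atZ hornerC.
  have c2 : `|c| ^+ 2 != 0 by rewrite expf_eq0 normr_eq0.
  move=> E; rewrite ctmxZ -scalemxAl -scalemxAr scalerA -normCK -E scalerA.
  by rewrite normfV -exprMn mulVf ?normr_eq0 // expr1n scale1r.
have Ec : c *: \prod_(x <- r :: s) ('X - x%:P) =
    ('X - r%:P) * (c *: \prod_(x <- s) ('X - x%:P)) by rewrite big_cons scalerAr.
rewrite Ec in nsq EG *.
have r1 : 1 <= `|r|.
  rewrite real_leNgt ?real1 ?normr_real //; apply/negP => /nsq.
  by rewrite hornerM hornerXsubC subrr mul0r eqxx.
have [G1 EG1 ES1] := divide_linear_factor lS nsG r1 EG.
have [|||G' EG' ES] := IH G1.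
- move=> z z1; have := nsG z z1; rewrite EG1 mx_atZ detZ.
  by rewrite mulf_eq0 negb_or => /andP[].
- by move=> z /nsq; rewrite hornerM mulf_eq0 negb_or => /andP[].
- exact: ES1.
by exists G' => //; rewrite EG1 EG' scalerA.
Qed.

(** * The degree of the factor *)

(** The polynomial z^d p(1/z), for p of degree at most d. *)
Definition reverse_poly (C : numClosedFieldType) (d : nat) (p : {poly C}) : {poly C} :=
  \poly_(l < d.+1) p`_(d - l).

Lemma horner_reverse_poly (C : numClosedFieldType) d (p : {poly C}) w :
  (size p <= d.+1)%N -> w != 0 -> (reverse_poly d p).[w] = w ^+ d * p.[w^-1].
Proof.
move=> sp w0; rewrite horner_poly (horner_coef_wide _ sp) mulr_sumr.
rewrite (reindex_inj rev_ord_inj) /=; apply: eq_bigr => l _.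
rewrite subSS; have ld : (l <= d)%N by rewrite -ltnS.
by rewrite subKn // mulrCA exprVn expfB_cond ?(negPf w0) //=.
Qed.

(** In terms of w = 1/z, the equation becomes an identity of polynomials
    w^d G(1/w) * G~(1/w) = w^(d - N) * (w^(2 N) P(1/w)). At w = 0 and for d > N
    it says that the coefficient of z^d in G times G(0)^* is zero. *)
Lemma size_outer_factor (C : numClosedFieldType) m N (P G : 'M[{poly C}]_m) :
  (forall i j, (size (P i j) <= N.*2.+1)%N) -> \det G.@[0] != 0 ->
  (forall z, `|z| = 1 -> z ^- N *: P.@[z] = G.@[z] *m (G.@[z])^t*) ->
  forall i j, (size (G i j) <= N.+1)%N.
Proof.
move=> sP G0 EG.
have step d : (N < d)%N -> (forall i j, (size (G i j) <= d.+1)%N) ->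
    forall i j, (size (G i j) <= d)%N.
  move=> Nd sG i j.
  pose Gr := map_mx (reverse_poly d) G; pose Gc := map_mx (map_poly Num.conj) G.
  have E : Gr *m Gc^T = 'X^(d - N) *: map_mx (reverse_poly N.*2) P.
    apply/matrixP => k l; apply/eqP; rewrite -subr_eq0; apply/eqP.
    apply: poly_circle_eq0 => w w1; have w0 := circle_neq0 w1.
    have w1' : `|w^-1| = 1 by rewrite normfV w1 invr1.
    have wc : (w^-1)^* = w by rewrite -{1}(conj_inv_circle w1) invrK conjCK.
    have Er : Gr.@[w] = w ^+ d *: G.@[w^-1].
      by apply/matrixP => a b; rewrite !mxE /horner_eval horner_reverse_poly.
    have Ec : (Gc^T).@[w] = (G.@[w^-1])^t*.
      by apply/matrixP => a b; rewrite !mxE /horner_eval -{1}wc horner_map.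
    have := EG _ w1'; rewrite exprVn invrK => EG'.
    have : (Gr *m Gc^T).@[w] = ('X^(d - N) *: map_mx (reverse_poly N.*2) P).@[w].
      rewrite mx_atM mx_atZ Er Ec -scalemxAl -EG' hornerXn scalerA.
      apply/matrixP => a b; rewrite !mxE /horner_eval horner_reverse_poly //.
      rewrite mulrA -!exprD; congr (w ^+ _ * _); lia.
    move=> /matrixP/(_ k l); rewrite hornerD hornerN !mxE /horner_eval => ->.
    by rewrite subrr.
  have := congr1 (fun A => A.@[0]) E; rewrite mx_atM mx_atZ hornerXn.
  rewrite expr0n subn_eq0 leqNgt Nd /= scale0r => E0.
  have u : (Gc^T).@[0] \in unitmx.
    have -> : (Gc^T).@[0] = (G.@[0])^t*.
      apply/matrixP => a b; rewrite !mxE /horner_eval.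
      by rewrite -{1}(conjC0 C) horner_map.
    by rewrite unitmxE unitfE det_ctmx conjC_eq0.
  have : Gr.@[0] = 0 by rewrite -[LHS](mulmxK u) E0 mul0mx.
  move=> /matrixP/(_ i j).
  rewrite !mxE /horner_eval horner_coef0 coef_poly /= subn0 => c0.
  apply/leq_sizeP => l; rewrite leq_eqVlt => /orP[/eqP <-//|dl].
  by apply: nth_default; apply: leq_trans (sG i j) dl.
have down e : (forall i j, (size (G i j) <= (N + e).+1)%N) ->
    forall i j, (size (G i j) <= N.+1)%N.
  elim: e => [|e IH]; first by rewrite addn0.
  by rewrite addnS => sG; apply: IH; apply: step => //; rewrite ltnS leq_addr.
apply: (down (\max_i \max_j size (G i j))) => i j.
apply: leqW; apply: leq_trans (leq_addl _ _).
apply: leq_trans (leq_bigmax (F := fun i => \max_j size (G i j)) i).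
exact: (leq_bigmax (F := fun j => size (G i j))).
Qed.

(** * Uniqueness *)

Lemma det_adj_neq0 (F : fieldType) m (A : 'M[F]_m) : \det A != 0 -> \det (\adj A) != 0.
Proof.
move=> A0; have /(congr1 determinant) := mul_mx_adj A.
rewrite det_mulmx det_scalar => E; apply: contraTneq isT => a0.
by move/eqP: E; rewrite a0 mulr0 eq_sym expf_eq0 (negPf A0) andbF.
Qed.

(** The quotient G2^-1 G1 is studied through adj(G2) G1, which is polynomial
    and equal to it up to the scalar factor det G2. *)
Lemma outer_factor_unique (C : numClosedFieldType) m (G1 G2 : 'M[{poly C}]_m) :
  nonsingular_disk G1 -> nonsingular_disk G2 ->
  (forall z, `|z| = 1 -> G1.@[z] *m (G1.@[z])^t* = G2.@[z] *m (G2.@[z])^t*) ->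
  exists2 U : 'M[C]_m, U \is unitarymx & forall z, G1.@[z] = G2.@[z] *m U.
Proof.
move=> ns1 ns2 E12; pose q := \det G2; pose W := \adj G2 *m G1.
have atW z : W.@[z] = \adj G2.@[z] *m G1.@[z] by rewrite mx_atM map_mx_adj.
have nsW : nonsingular_disk W.
  by move=> z z1; rewrite atW det_mulmx mulf_neq0 ?ns1 // det_adj_neq0 // ns2.
have nsq z : `|z| < 1 -> q.[z] != 0 by move/ns2; rewrite det_at.
have EW z : `|z| = 1 -> `|q.[z]| ^+ 2 *: 1%:M = W.@[z] *m (W.@[z])^t*.
  move=> z1; rewrite atW ctmxM mulmxA -[_ *m _ *m (G1.@[z])^t*]mulmxA E12 //.
  rewrite mulmxA mul_adj_mx -mulmxA -ctmxM mul_adj_mx ctmx_scalar -scalar_mxM.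
  by rewrite det_at -normCK scale_scalar_mx mulr1.
have [|U [EU nsU UU]] := divide_outer (S := fun=> 1%:M) _ nsW nsq EW.
  by move=> i j; exact: laurent_cst.
have sU i j : (size (U i j) <= 1)%N.
  apply: (@size_outer_factor C m 0 1%:M U) => [k l||z z1].
  - by rewrite mxE; case: (k == l); rewrite ?mulr1n ?mulr0n ?size_poly1 ?size_poly0.
  - by apply: nsU; rewrite normr0 ltr01.
  - by rewrite map_mx1 expr0 invr1 scale1r -UU.
have atU z : U.@[z] = U.@[0].
  apply/matrixP => i j; rewrite !mxE /horner_eval (size1_polyC (sU i j)).
  by rewrite !hornerC.
have q0 : q != 0.
  by apply: contraNneq (nsq 0 _) => [->|]; rewrite ?horner0 // normr0 ltr01.
exists U.@[0]; first by apply/unitarymxP; rewrite -(atU 1) -UU ?normr1.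
move=> z; rewrite -(atU z) -mx_atM; congr (_.@[z]).
have : q *: (G2 *m U) = q *: G1.
  by rewrite scalemxAr -EU mulmxA mul_mx_adj mul_scalar_mx.
move=> E; apply/matrixP => i j; apply: (mulfI q0).
by have /matrixP/(_ i j) := E; rewrite !mxE.
Qed.

(** * Sets of full arc length measure *)

Lemma circle_angle (R : realType) (x y : R) : x ^+ 2 + y ^+ 2 = 1 ->
  exists2 t : R, t \in `[0, 2 * pi[ & x = cos t /\ y = sin t.
Proof.
move=> xy; have x1 : -1 <= x <= 1.
  by rewrite -ler_norml -(@ler_pXn2r _ 2) ?nnegrE // expr1n
    real_normK ?num_real // -xy lerDl sqr_ge0.
have Ex : cos (acos x) = x by rewrite acosK // in_itv.
have Ey : sin (acos x) = `|y|.
  by rewrite sin_acos // -xy addrAC subrr add0r sqrtr_sqr.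
have p0 := pi_gt0 R; have a0 := acos_ge0 x1; have a1 := acos_lepi x1.
have [y0|y0] := leP 0 y.
  exists (acos x); last by rewrite Ex Ey ger0_norm.
  by rewrite in_itv /= a0 /=; lra.
exists (2 * pi - acos x).
  rewrite in_itv /=; apply/andP; split; first by lra.
  rewrite gtrBl lt_def a0 andbT; apply/eqP => ax0.
  by move: Ey; rewrite ax0 sin0 => /esym/eqP; rewrite normr_eq0 (lt_eqF y0).
rewrite addrC mulr_natl cosD2pi sinD2pi cosN sinN Ex Ey ltr0_norm // opprK //.
Qed.

(** A null set contains no interval, so admissible angles exist just above any
    given angle; this side is available for every angle of [0, 2 pi[. *)
Lemma ae_circle_dense (R : realType) (P : R[i] -> Prop) :
  ae_circle P -> dense_circle (fun z : R[i] => `|z| = 1 /\ P z).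
Proof.
move=> aeP; split=> [z []//|[x y] [e e'] r1]; rewrite ltcE /= => /andP[/eqP -> e0].
have [t0] : exists2 t : R, t \in `[0, 2 * pi[ & x = cos t /\ y = sin t.
  apply: circle_angle; move: r1; rewrite normc_def /= => -[/(congr1 (fun u => u ^+ 2))].
  by rewrite sqr_sqrtr ?addr_ge0 ?sqr_ge0 // expr1n.
rewrite in_itv /= => /andP[t00 t01] [-> ->].
have e2 : 0 < e / 2 by rewrite divr_gt0.
have /cvgrPdist_lt/(_ _ e2)/nbhs_ballP[d1 /= d10 H1] := @continuous_cos R t0.
have /cvgrPdist_lt/(_ _ e2)/nbhs_ballP[d2 /= d20 H2] := @continuous_sin R t0.
pose b := Num.min (2 * pi) (t0 + Num.min d1 d2).
have tb : t0 < b by rewrite lt_min t01 ltrDl lt_min d10 d20.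
have [t] : exists t, (t \in `]t0, b[) /\ P (Complex (cos t) (sin t)).
  apply: contrapT => /forallNP noP.
  have : (@lebesgue_measure R).-negligible (`]t0, b[%classic).
    apply: negligibleS aeP => t /= tI Pt; apply: (noP t); split=> //.
    apply: Pt; move: tI; rewrite !in_itv /= lt_min => /and3P[tt0 t2 _].
    by rewrite (le_trans t00 (ltW tt0)).
  move/negligibleP => /(_ (measurable_itv _)) m0.
  have := etrans (esym (lebesgue_measure_itv `]t0, b[)) m0.
  by rewrite /= lte_fin tb -EFinB => -[/eqP]; rewrite subr_eq0 (gt_eqF tb).
rewrite in_itv /= !lt_min => -[/and3P[tt0 _]].
rewrite -ltrBlDl lt_min => /andP[td1 td2] Pt.
have dt : `|t0 - t| = t - t0 by rewrite distrC gtr0_norm ?subr_gt0.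
have := H1 t; rewrite /ball /= dt => /(_ td1) c1.
have := H2 t; rewrite /ball /= dt => /(_ td2) c2.
exists (Complex (cos t) (sin t)); split; first split=> //.
  by rewrite normc_def /= cos2Dsin2 sqrtr1.
rewrite normc_def ltcR /= -(gtr0_norm e0) -sqrtr_sqr ltr_sqrt ?exprn_gt0 //.
have sq (u v : R) : `|u - v| < e / 2 -> (v - u) ^+ 2 < (e / 2) ^+ 2.
  move=> uv; rewrite -[ltLHS]real_normK ?num_real // distrC.
  by rewrite ltr_pXn2r ?nnegrE // ltW.
apply: (lt_le_trans (ltrD (sq _ _ c1) (sq _ _ c2))); nra.
Qed.

(** * Existence *)

Lemma posdefmx_det_neq0 (R : realType) m (A : 'M[R[i]]_m) :
  posdefmx A -> \det A != 0.
Proof.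
move=> [_ pos]; apply/negP => /det0P[v v0 vA].
have := pos (v^t*); rewrite ctmxK vA mul0mx mxE ltxx => H; apply/notF/H.
by apply: contraNneq v0 => E; rewrite -[v]ctmxK E trmx0 map_mx0.
Qed.

(** The numerator z^N S(z). *)
Definition laurent_num (R : realType) m N (C : int -> 'M[R[i]]_m) : 'M[{poly R[i]}]_m :=
  \matrix_(i, j) \poly_(k < N.*2.+1) C (k%:Z - N%:Z) i j.

Lemma laurent_mxE (R : realType) m N (C : int -> 'M[R[i]]_m) z :
  z != 0 -> laurent_mx N C z = z ^ (- N%:Z) *: (laurent_num N C).@[z].
Proof.
move=> z0; apply/matrixP => i j; rewrite !mxE /horner_eval summxE horner_poly mulr_sumr.
apply: eq_bigr => k _; rewrite !mxE addrC expfzDr // -mulrA; congr (_ * _).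
by rewrite mulrC addrC.
Qed.

Lemma laurent_laurent_mx (R : realType) m N (C : int -> 'M[R[i]]_m) i j :
  laurent (fun z => laurent_mx N C z i j).
Proof.
exists (laurent_num N C i j), (- N%:Z) => z z0.
by rewrite laurent_mxE // mxE mulrC [in LHS]mxE.
Qed.

(** Elimination provides a denominator q and a numerator G; the roots of q and
    of det G are moved out of the disk, after which q cancels. *)
Lemma spectral_factor_poly (R : realType) m N (C : int -> 'M[R[i]]_m) :
  ae_circle (fun z : R[i] => posdefmx (laurent_mx N C z)) ->
  exists G : 'M[{poly R[i]}]_m, [/\ forall i j, (size (G i j) <= N.+1)%N,
    nonsingular_disk G &
    forall z, `|z| = 1 -> laurent_mx N C z = G.@[z] *m (G.@[z])^t*].
Proof.
move/ae_circle_dense; set E := (fun z => _) => dE.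
have [|q [G [q0 EG]]] := posdefmx_laurent_sqr (k := - N%:Z) (P := laurent_num N C) dE.
  by move=> z [z1 pz]; rewrite -laurent_mxE ?circle_neq0.
have {}EG z : `|z| = 1 -> `|q.[z]| ^+ 2 *: laurent_mx N C z = G.@[z] *m (G.@[z])^t*.
  move=> z1; apply/matrixP => i j; rewrite [LHS]mxE.
  apply/eqP; rewrite -subr_eq0; apply/eqP.
  have := laurent_dense_eq0 dE
    (laurent_defect q G i j (@laurent_laurent_mx _ _ N C)) _ z1.
  rewrite conj_inv_circle // -normCK; apply=> w wE.
  have w1 : `|w| = 1 by case: wE.
  rewrite conj_inv_circle // -normCK -EG // -laurent_mxE ?circle_neq0 //.
  by rewrite [X in _ - X]mxE subrr.
have [z0 [[z01 pz0] qz0]] : exists z, E z /\ q.[z] != 0.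
  apply: contrapT => /forallNP noz; case/negP: q0; apply/eqP.
  apply: poly_circle_eq0; apply: (laurent_dense_eq0 dE (laurent_horner q)) => z zE.
  by apply/eqP/negPn/negP => qz; apply: (noz z).
have G0 : \det G != 0.
  apply: contraTneq (posdefmx_det_neq0 pz0) => dG.
  have /(congr1 determinant)/eqP := EG _ z01.
  rewrite detZ det_mulmx det_at dG horner0 mul0r mulf_eq0 expf_eq0.
  by rewrite expf_eq0 normr_eq0 (negPf qz0) !andbF negbK.
have [G1 [E1 ns1]] := outer_factor G0.
have [q1 [Eq nsq]] := reflect_roots q0.
have [|G2 [_ ns2 E2]] := divide_outer (@laurent_laurent_mx _ _ N C) ns1 nsq.
  by move=> z z1; rewrite Eq // E1 // EG.
exists G2; split=> //; apply: (size_outer_factor (P := laurent_num N C)).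
- by move=> i j; rewrite mxE; exact: size_poly.
- by apply: ns2; rewrite normr0 ltr01.
- by move=> z z1; rewrite -E2 // laurent_mxE ?circle_neq0 // exprnN.
Qed.

(** * The exterior of the disk *)

Definition poly_of_mx (R : realType) m N
    (A : 'I_N.+1 -> 'M[R[i]]_m) : 'M[{poly R[i]}]_m :=
  \matrix_(i, j) \poly_(n < N.+1) A (inord n) i j.

Lemma poly_mxE (R : realType) m N (A : 'I_N.+1 -> 'M[R[i]]_m) z :
  poly_mx A z = (poly_of_mx A).@[z].
Proof.
apply/matrixP => i j; rewrite !mxE /horner_eval summxE horner_poly.
by apply: eq_bigr => n _; rewrite !mxE mulrC inord_val.
Qed.

Lemma poly_of_mxK (R : realType) m N (G : 'M[{poly R[i]}]_m) :
  (forall i j, (size (G i j) <= N.+1)%N) ->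
  poly_of_mx (fun n : 'I_N.+1 => \matrix_(i, j) (G i j)`_n) = G.
Proof.
move=> sG; apply/matrixP => i j; apply/polyP => n; rewrite mxE coef_poly.
by case: ltnP => nN; [rewrite mxE inordK | rewrite nth_default // (leq_trans _ nN)].
Qed.

Lemma para_adjE (R : realType) m (F : R[i] -> 'M[R[i]]_m) z :
  para_adj F z = (F (z^*)^-1)^t*.
Proof. by rewrite /para_adj div1r. Qed.

Lemma derivable_sum_exprn (K : numFieldType) (n : nat) (c : 'I_n -> K) (z : K^o) :
  derivable (fun w : K^o => \sum_(k < n) w ^+ k * c k : K^o) z 1.
Proof.
have -> : (fun w : K^o => \sum_(k < n) w ^+ k * c k : K^o) =
    \sum_(k < n) (fun w : K^o => w ^+ k * c k : K^o).
  by apply/funext => w; rewrite fct_sumE.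
apply: derivable_sum => k; apply: derivableM; last exact: derivable_cst.
exact: exprn_derivable.
Qed.

Lemma derivable_sum_exprVn (K : numFieldType) (n : nat) (c : 'I_n -> K) (z : K^o) :
  z != 0 -> derivable (fun w : K^o => \sum_(k < n) w ^- k * c k : K^o) z 1.
Proof.
move=> z0; have -> : (fun w : K^o => \sum_(k < n) w ^- k * c k : K^o) =
    \sum_(k < n) (fun w : K^o => w ^- k * c k : K^o).
  by apply/funext => w; rewrite fct_sumE.
apply: derivable_sum => k; apply: derivableM; last exact: derivable_cst.
by apply: derivableV; [exact: expf_neq0 | exact: exprn_derivable].
Qed.

Lemma para_adj_exterior (R : realType) m N (A : 'I_N.+1 -> 'M[R[i]]_m) :
  nonsingular_on [set z | `|z| < 1] (poly_mx A) ->
  analytic_nonsingular_exterior (para_adj (poly_mx A)).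
Proof.
move=> ns.
have entry z i j : para_adj (poly_mx A) z i j = \sum_(n < N.+1) z ^- n * (A n j i)^*.
  by rewrite para_adj_poly_mx summxE; apply: eq_bigr => n _; rewrite !mxE.
split.
- move=> z /= z1 i j.
  have -> : (fun w : (R[i])^o => para_adj (poly_mx A) w i j : (R[i])^o) =
      (fun w => \sum_(n < N.+1) w ^- n * (A n j i)^*).
    by apply/funext => w; rewrite entry.
  apply: derivable_sum_exprVn.
  by rewrite -normr_gt0 (lt_trans ltr01).
- move=> z /= z1; rewrite para_adjE det_ctmx conjC_eq0; apply: ns => /=.
  by rewrite normfV norm_conjC invf_lt1 // (lt_trans ltr01).
exists ((A ord0)^t*); split.
  rewrite det_ctmx conjC_eq0; have := ns 0; rewrite /= normr0 => /(_ ltr01).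
  rewrite /poly_mx big_ord_recl expr0 scale1r big1 ?addr0 // => k _.
  by rewrite expr0n scale0r.
move=> z _ i j.
have -> : (fun w : (R[i])^o =>
    (if w == 0 then (A ord0)^t* else para_adj (poly_mx A) (1 / w)) i j : (R[i])^o) =
    (fun w => \sum_(n < N.+1) w ^+ n * (A n j i)^*).
  apply/funext => w; case: eqP => [->|_].
    rewrite big_ord_recl expr0 mul1r big1 ?addr0 => [|k _]; first by rewrite !mxE.
    by rewrite expr0n mul0r.
  by rewrite entry; apply: eq_bigr => n _; rewrite div1r exprVn invrK.
exact: derivable_sum_exprn.
Qed.

(** * Spectral factorization *)

Theorem theorem1 (R : realType) (m N : nat) (hm : (1 <= m)%N)
    (C : int -> 'M[R[i]]_m)
    (hC : ae_circle (fun z : R[i] => posdefmx (laurent_mx N C z))) :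
  (exists A : 'I_N.+1 -> 'M[R[i]]_m,
     spectral_factor C A /\
     analytic_nonsingular_exterior (para_adj (poly_mx A))) /\
  (forall A1 A2 : 'I_N.+1 -> 'M[R[i]]_m,
     spectral_factor C A1 -> spectral_factor C A2 ->
     exists U : 'M[R[i]]_m,
       U \is unitarymx /\
       forall z : R[i], poly_mx A1 z = poly_mx A2 z *m U).
Proof.
split.
  have [G [sG nsG EG]] := spectral_factor_poly hC.
  pose A (n : 'I_N.+1) := \matrix_(i, j) (G i j)`_n.
  have EA z : poly_mx A z = G.@[z] by rewrite poly_mxE poly_of_mxK.
  have nsA : nonsingular_on [set z | `|z| < 1] (poly_mx A).
    by move=> z /= /nsG; rewrite EA.
  exists A; split; last exact: para_adj_exterior.
  split=> // z z0; rewrite para_adjE !EA.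
  apply/matrixP => i j; apply/eqP; rewrite -subr_eq0; apply/eqP; move: z z0.
  apply: laurent_eq0 => [|z z1].
    by apply: laurentB; [exact: laurent_laurent_mx | exact: laurent_mulmx_ct].
  by rewrite conj_inv_circle // EG // subrr.
have onT (A : 'I_N.+1 -> 'M[R[i]]_m) : spectral_factor C A ->
    nonsingular_disk (poly_of_mx A) /\
    forall z, `|z| = 1 ->
      (poly_of_mx A).@[z] *m ((poly_of_mx A).@[z])^t* = laurent_mx N C z.
  move=> [EC ns]; split=> [z /ns|z z1]; first by rewrite poly_mxE.
  by rewrite EC ?circle_neq0 // para_adjE !poly_mxE conj_inv_circle.
move=> A1 A2 /onT[ns1 E1] /onT[ns2 E2].
have [|U uU EU] := outer_factor_unique ns1 ns2.
  by move=> z z1; rewrite E1 // E2.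
by exists U; split=> // z; rewrite !poly_mxE.
Qed.
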